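(* Let $P_0$ be a probability distribution on a measurable space $\mathcal Z$, let $G:\mathbb R^d\times\mathcal Z\to\mathbb R^d$ be the clipped detached gradient field defined in the context, and let $h(\theta)=\mathbb E_{Z\sim P_0}[G(\theta,Z)]$. Assume: (U1) $Z_1,Z_2,\dots$ are random draws such that, with $\mathcal F_t=\sigma(\theta_0,Z_1,\dots,Z_t)$, for every $t\ge0$ the conditional distribution of $Z_{t+1}$ given $\mathcal F_t$ is $P_0$. (U2) $G$ is (jointly) measurable and $\|G(\theta,z)\|_2\le G_0=1$ for all $\theta,z$. (U3) There are a nonempty closed convex set $\mathcal B\subseteq\mathbb R^d$, a point $\theta^\dagger\in\mathcal B$ with $h(\theta^\dagger)=0$, and $\mu>0$ such that $$\langle\theta-\theta^\dagger,h(\theta)\rangle\ge\mu\|\theta-\theta^\dagger\|_2^2\quad\text{for every }\theta\in\mathcal B.$$ Let $0<\eta<1/(2\mu)$, let $\theta_0\in\mathcal B$ be deterministic, and define $\theta_{t+1}=\Pi_{\mathcal B}[\theta_t-\eta\,G(\theta_t,Z_{t+1})]$ for $t\ge0$, where $\Pi_{\mathcal B}$ is the Euclidean projection onto $\mathcal B$. Then for every integer $T\ge0$, $$\mathbb E\|\theta_T-\theta^\dagger\|_2^2\le(1-2\mu\eta)^T\|\theta_0-\theta^\dagger\|_2^2+\frac{\eta G_0^2}{2\mu}.$$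
   Context: A draw $Z\in\mathcal Z$ consists of a preference minibatch (prompt, preferred image, dispreferred image) together with all diffusion randomness used in one gradient calculation. Given are a loss $\ell(\theta,z;w)$, differentiable in $\theta\in\mathbb R^d$, and a map $\mathcal W_{\mathrm{ref}}$ assigning to each draw $z$ a weight array $w=\mathcal W_{\mathrm{ref}}(z)$ (computed by a frozen reference model, so not depending on $\theta$). The detached gradient is $\widetilde G(\theta,z)=\nabla_\theta\,\ell(\theta,z;w)\big|_{w=\mathcal W_{\mathrm{ref}}(z)}$: the weight array is recomputed from the same $z$ but treated as a constant in differentiation. The clipped field is $G(\theta,z)=\operatorname{Clip}_{1.0}(\widetilde G(\theta,z))$, where $\operatorname{Clip}_{1.0}(g)=g$ if $\|g\|_2\le1$ and $\operatorname{Clip}_{1.0}(g)=g/\|g\|_2$ otherwise. The result uses only the properties (U1)--(U3) of $G$ and $P_0$. *)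

(* Defs.v *)
From HB Require Import structures.
From mathcomp Require Import all_boot all_order all_algebra.
From mathcomp Require Import all_classical all_reals all_analysis.
From mathcomp Require Import measurable_realfun.

Set Implicit Arguments.
Unset Strict Implicit.
Unset Printing Implicit Defensive.

Import Order.TTheory GRing.Theory Num.Theory.
Import numFieldNormedType.Exports.

Local Open Scope classical_set_scope.
Local Open Scope ring_scope.

Section euclidean_space.
Context {R : realType} {d : nat}.
Implicit Types (u v x : 'rV[R]_d) (B : set 'rV[R]_d).

Definition dot u v : R := \sum_(i < d) u 0 i * v 0 i.

(* The library norm `|v| on row vectors is the sup norm, hence this one; both
   induce the same topology. *)
Definition enorm v : R := Num.sqrt (dot v v).

Definition grad (f : 'rV[R]_d -> R) x : 'rV[R]_d :=
  \row_(i < d) 'D_(delta_mx 0 i) f x.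

Definition clip1 v : 'rV[R]_d :=
  if enorm v <= 1 then v else (enorm v)^-1 *: v.

(* A point of B nearest to x; it exists and is unique when B is nonempty,
   closed and convex, and the default value x is irrelevant in that case. *)
Definition eproj B x : 'rV[R]_d :=
  xget x [set p | B p /\ forall q, B q -> enorm (x - p) <= enorm (x - q)].

End euclidean_space.

(* R^d with its Borel sigma-algebra *)
Definition borel_rV (R : realType) (d : nat) :=
  g_sigma_algebraType (@open 'rV[R]_d).

Section stochastic.
Context {R : realType} {dO dZ : measure_display}.
Context {Omega : measurableType dO} {Zt : measurableType dZ}.

(* kappa is a version of the conditional distribution of X given the
   sub-sigma-algebra F: for every measurable B, the function kappa _ B is
   F-measurable and integrates to P (A `&` [X in B]) over each A in F. *)
Definition is_cond_distribution (P : probability Omega R)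
    (F : set (set Omega)) (X : Omega -> Zt)
    (kappa : Omega -> probability Zt R) : Prop :=
  forall B : set Zt, measurable B ->
    preimage_set_system setT (fun om => kappa om B)
      measurable `<=` F /\
    (forall A : set Omega, F A ->
      (\int[P]_(om in A) kappa om B = P (A `&` X @^-1` B))%E).

(* sigma(theta0, Z_1, ..., Z_t); the value Z 0 is never used. *)
Definition history (d : nat) (theta0 : Omega -> borel_rV R d)
    (Z : nat -> Omega -> Zt) (t : nat) : set (set Omega) :=
  <<s preimage_set_system setT theta0 measurable `|`
      \bigcup_(s in [set s | (1 <= s <= t)%N])
        preimage_set_system setT (Z s) measurable >>.

Context {d : nat}.

(* The weights Wref z are evaluated once at z and held constant in th. *)
Definition detached_grad (W : Type) (loss : 'rV[R]_d -> Zt -> W -> R)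
    (Wref : Zt -> W) (theta : 'rV[R]_d) (z : Zt) : 'rV[R]_d :=
  let w := Wref z in grad (fun th => loss th z w) theta.

Definition clipped_field (W : Type) (loss : 'rV[R]_d -> Zt -> W -> R)
    (Wref : Zt -> W) (theta : 'rV[R]_d) (z : Zt) : 'rV[R]_d :=
  clip1 (detached_grad loss Wref theta z).

Definition mean_field (P0 : probability Zt R)
    (G : 'rV[R]_d -> Zt -> 'rV[R]_d) (theta : 'rV[R]_d) : 'rV[R]_d :=
  \row_(i < d) fine 'E_P0[fun z => G theta z 0 i].

Fixpoint iterate (B : set 'rV[R]_d) (eta : R)
    (G : 'rV[R]_d -> Zt -> 'rV[R]_d) (theta0 : 'rV[R]_d)
    (Z : nat -> Omega -> Zt) (t : nat) (om : Omega) : 'rV[R]_d :=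
  if t is t'.+1 then
    let th := iterate B eta G theta0 Z t' om in
    eproj B (th - eta *: G th (Z t'.+1 om))
  else theta0.

End stochastic.

(* Main.v *)
(* The projection onto B is nonexpansive and fixes the root p, so
   |theta_{t+1} - p|^2 <= |theta_t - p - eta G(theta_t, Z_{t+1})|^2. As theta_t
   is measurable with respect to the history, Z_{t+1} is independent of it with
   law P0, and Tonelli lets one integrate out Z_{t+1} with theta_t frozen.
   Expanding the square, monotonicity of the mean field gives
   D_{t+1} <= (1 - 2 mu eta) D_t + eta^2 G0^2 for the mean square distance D_t,
   whose fixed point is eta G0^2 / (2 mu). *)
Require Import Defs.
From HB Require Import structures.
From mathcomp Require Import all_boot all_order all_algebra.
From mathcomp Require Import all_classical all_reals all_analysis.
From mathcomp Require Import measurable_realfun.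
From mathcomp Require Import ring lra.

Set Implicit Arguments.
Unset Strict Implicit.
Unset Printing Implicit Defensive.

Import Order.TTheory GRing.Theory Num.Theory.
Import numFieldNormedType.Exports.

Local Open Scope classical_set_scope.
Local Open Scope ring_scope.

(** * Euclidean geometry and the projection onto a closed convex set *)

Section euclidean_geometry.
Context {R : realType} {d : nat}.
Implicit Types (u v w x y p q : 'rV[R]_d) (B : set 'rV[R]_d).

Lemma dotC u v : dot u v = dot v u.
Proof. by apply: eq_bigr => i _; rewrite mulrC. Qed.

Lemma dotDl u v w : dot (u + v) w = dot u w + dot v w.
Proof. by rewrite -big_split; apply: eq_bigr => i _; rewrite mxE mulrDl. Qed.

Lemma dotZl a u v : dot (a *: u) v = a * dot u v.
Proof. by rewrite mulr_sumr; apply: eq_bigr => i _; rewrite mxE mulrA. Qed.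

Lemma dotNl u v : dot (- u) v = - dot u v.
Proof. by rewrite -scaleN1r dotZl mulN1r. Qed.

Lemma dotBl u v w : dot (u - v) w = dot u w - dot v w.
Proof. by rewrite dotDl dotNl. Qed.

Lemma dotBr u v w : dot u (v - w) = dot u v - dot u w.
Proof. by rewrite dotC dotBl !(dotC _ u). Qed.

Lemma dotZr a u v : dot u (a *: v) = a * dot u v.
Proof. by rewrite dotC dotZl dotC. Qed.

Lemma dot_ge0 v : 0 <= dot v v.
Proof. by apply: sumr_ge0 => i _; rewrite -expr2 sqr_ge0. Qed.

Lemma dotB_sqr u v : dot (u - v) (u - v) = dot u u - 2 * dot u v + dot v v.
Proof. by rewrite !(dotBl, dotBr) (dotC v u); ring. Qed.

Lemma enorm_sqr v : enorm v ^+ 2 = dot v v.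
Proof. by rewrite sqr_sqrtr ?dot_ge0. Qed.

Lemma enorm_le u v : (enorm u <= enorm v) = (dot u u <= dot v v).
Proof. by rewrite ler_sqrt ?dot_ge0. Qed.

Lemma coord_le_enorm v i : `|v 0 i| <= enorm v.
Proof.
rewrite -sqrtr_sqr ler_sqrt ?dot_ge0// /dot (bigD1 i)//= expr2 lerDl.
by apply: sumr_ge0 => j _; rewrite -expr2 sqr_ge0.
Qed.

(** The topology of row vectors comes from the sup norm, so this carries Euclidean estimates over to
    boundedness and convergence. *)
Lemma norm_le_enorm v : `|v| <= enorm v.
Proof.
rewrite [leLHS]/Num.norm /= mx_normrE; apply/bigmax_leP; split.
  exact: sqrtr_ge0.
by move=> [i j] _ /=; rewrite ord1 coord_le_enorm.
Qed.

Lemma continuous_dot_self : continuous (fun v => dot v v).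
Proof.
apply: continuous_big => [|i _ v]; first exact: add_continuous.
have cvi := @coord_continuous R 1 d 0 i v.
exact: (cvgM cvi cvi).
Qed.

Lemma continuous_dot_sub x : continuous (fun q => dot (x - q) (x - q)).
Proof.
move=> q.
have cs : {for q, continuous (fun q => x - q)}.
  by apply: (@continuousB _ _ _ (fun=> x) id q);
    [exact: cst_continuous | exact: cvg_id].
exact: (continuous_comp cs (@continuous_dot_self (x - q))).
Qed.

(** Only points of [B] no farther from [x] than a fixed [b] in [B] can be nearest. They form a
    closed set, bounded by the triangle inequality, so the continuous squared distance attains its
    minimum there. *)
Lemma eproj_exists B x : B !=set0 -> closed B ->
  exists p, B p /\ forall q, B q -> enorm (x - p) <= enorm (x - q).
Proof.
move=> [b Bb] cB; pose f q := dot (x - q) (x - q).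
have cf : continuous f by exact: continuous_dot_sub.
pose A := B `&` f @^-1` [set r | r <= f b].
have cA : closed A.
  apply: closedI => //; apply: preimage_closed; last exact: closed_le.
  by move=> ? _; exact: cf.
have bA : bounded_set A.
  exists (`|x| + enorm (x - b)); split; first exact: num_real.
  move=> M ltM q [_ /= fq]; apply/ltW/(le_lt_trans _ ltM).
  rewrite -[q in `|q|](subKr x) (le_trans (ler_normB _ _))// lerD2l.
  by rewrite (le_trans (norm_le_enorm _))// enorm_le.
have A0 : A !=set0 by exists b; split => //=.
have [|p /set_mem[Bp fp] minp] :=
  EVT_min_rV (f := f) A0 (bounded_closed_compact bA cA).
  by apply: continuous_subspaceT.
exists p; split => // q Bq; rewrite enorm_le.
have [fq|fq] := leP (f q) (f b); first by apply: minp; rewrite inE.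
exact: le_trans fp (ltW fq).
Qed.

Lemma eproj_spec B x : B !=set0 -> closed B ->
  B (eproj B x) /\ forall q, B q -> enorm (x - eproj B x) <= enorm (x - q).
Proof.
move=> B0 cB; have [p Pp] := eproj_exists x B0 cB.
by rewrite /eproj; case: xgetP => [y _ []|/(_ p)].
Qed.

Lemma eproj_in B x : B !=set0 -> closed B -> B (eproj B x).
Proof. by move=> B0 cB; have [] := eproj_spec x B0 cB. Qed.

Lemma eproj_variational B x q : B !=set0 -> closed B -> convex_set B -> B q ->
  dot (x - eproj B x) (q - eproj B x) <= 0.
Proof.
move=> B0 cB convB Bq; have [Bp minp] := eproj_spec x B0 cB.
set p := eproj B x in Bp minp *; set s := dot _ _; rewrite leNgt.
apply/negP => s_gt0; set n := dot (q - p) (q - p).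
have n_ge0 : 0 <= n by exact: dot_ge0.
(* Moving from p towards q by l = s/(s+n) strictly decreases the distance to
   x. *)
have sn_gt0 : 0 < s + n by rewrite ltr_wpDr.
pose l := s / (s + n).
have l_gt0 : 0 < l by rewrite divr_gt0.
have lE : l * (s + n) = s by rewrite mulfVK// gt_eqF.
have l01 : 0 <= l <= 1.
  by rewrite ltW//= ler_pdivrMr// mul1r lerDl.
have Bl : B (l *: q + (1 - l) *: p).
  exact/set_mem/(convB q p (@Itv01 R l (andP l01).1 (andP l01).2)
    (mem_set Bq) (mem_set Bp)).
have := minp _ Bl; rewrite enorm_le.
have -> : x - (l *: q + (1 - l) *: p) = (x - p) - l *: (q - p).
  rewrite scalerBr scalerBl scale1r !opprD !opprK -!addrA; congr (_ + _).
  by rewrite addrCA.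
rewrite [in X in _ <= X -> _]dotB_sqr dotZr dotZl dotZr -/s -/n.
(* Here [h] says that [- 2 l s + l^2 n] is nonnegative. By [lE], [l n = s - l s], so this quantity
   equals [- l s (1 + l)], which is negative. *)
by rewrite -addrA lerDl => h; nra.
Qed.

Lemma eproj_id B x : B !=set0 -> closed B -> B x -> eproj B x = x.
Proof.
move=> B0 cB Bx; have [_ /(_ x Bx)] := eproj_spec x B0 cB.
rewrite subrr enorm_le => h; apply/eqP; rewrite eq_sym -subr_eq0 -normr_le0.
apply: le_trans (norm_le_enorm _) _.
have dot0 : dot (0 : 'rV[R]_d) 0 = 0 by rewrite -(scale0r 0) dotZl mul0r.
have -> : 0 = enorm (0 : 'rV[R]_d) by rewrite /enorm dot0 sqrtr0.
by rewrite enorm_le.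
Qed.

(** With [p], [q] the two projections, adding their variational inequalities, each tested at the
    other point, gives [|p - q|^2 <= <x - y, p - q>]. Expanding [|(x - y) - (p - q)|^2 >= 0] then
    finishes. *)
Lemma eproj_nonexpansive B x y : B !=set0 -> closed B -> convex_set B ->
  dot (eproj B x - eproj B y) (eproj B x - eproj B y) <= dot (x - y) (x - y).
Proof.
move=> B0 cB convB.
have hx := eproj_variational x B0 cB convB (eproj_in y B0 cB).
have hy := eproj_variational y B0 cB convB (eproj_in x B0 cB).
set p := eproj B x in hx hy *; set q := eproj B y in hx hy *.
have := dot_ge0 ((x - y) - (p - q)); rewrite dotB_sqr.
have : dot (x - p) (q - p) + dot (y - q) (p - q)
     = dot (p - q) (p - q) - dot (x - y) (p - q).
  rewrite !(dotBl, dotBr) (dotC q p); ring.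
lra.
Qed.

(** Continuity follows from nonexpansiveness, and it is what makes the projected iterates Borel
    measurable. *)
Lemma continuous_eproj B : B !=set0 -> closed B -> convex_set B ->
  continuous (eproj B).
Proof.
move=> B0 cB convB x; apply/(@cvgrPdist_lt _ _ _ (nbhs x) _) => e e_gt0.
have c0 : (fun y => dot (x - y) (x - y)) @ x --> 0.
  have -> : 0 = dot (x - x) (x - x).
    by rewrite subrr -(scale0r (0 : 'rV[R]_d)) dotZl mul0r.
  exact: continuous_dot_sub.
have e2 : 0 < e ^+ 2 by rewrite exprn_gt0.
move/cvgr_lt : c0 => /(_ _ e2); apply: filterS => y xy.
apply: le_lt_trans (norm_le_enorm _) _.
rewrite -(ltr_pXn2r (n := 2)) ?nnegrE ?sqrtr_ge0 ?ltW// enorm_sqr.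
exact: le_lt_trans (eproj_nonexpansive _ _ B0 cB convB) xy.
Qed.

End euclidean_geometry.

(** * Borel measurability of vector-valued maps *)

Section borel_measurability.
Context {R : realType} {d : nat}.

Lemma continuous_measurable_borel_rV (f : 'rV[R]_d -> R) : continuous f ->
  measurable_fun [set: borel_rV R d] (f : borel_rV R d -> R).
Proof.
move=> /continuousP cf; apply: (measurability _ (RGenOpens.measurableE R)).
move=> _ [_ [a [b ->] <-]]; rewrite setTI; apply: sub_sigma_algebra.
exact/cf/interval_open.
Qed.

Lemma measurable_coord (i : 'I_d) :
  measurable_fun [set: borel_rV R d] (fun v : borel_rV R d => v 0 i).
Proof.
apply: (@continuous_measurable_borel_rV (fun v => v 0 i)).
exact: coord_continuous.
Qed.

Lemma continuous_endo_measurable (f : 'rV[R]_d -> 'rV[R]_d) :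
  continuous f ->
  measurable_fun [set: borel_rV R d] (f : borel_rV R d -> borel_rV R d).
Proof.
move=> /continuousP cf.
apply: (@measurability _ _ _ (borel_rV R d) _ _ (@open 'rV[R]_d)) => //.
move=> _ [U oU <-]; rewrite setTI; apply: sub_sigma_algebra.
exact: cf.
Qed.

(** Second countability in explicit form: balls with rational centre and radius are a base indexed
    by a countable type. *)
Lemma rat_ball_rV (U : set 'rV[R]_d) (x : 'rV[R]_d) : open U -> U x ->
  exists (q : 'rV[rat]_d) (e : rat),
    ball (map_mx ratr q : 'rV[R]_d) (ratr e) x /\
    ball (map_mx ratr q : 'rV[R]_d) (ratr e) `<=` U.
Proof.
move=> oU Ux; have /nbhs_ballP[r /= r_gt0 rU] : nbhs x U.
  by apply: open_nbhs_nbhs.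
(* Half of [r] suffices: a ball of radius [e] containing [x] lies in the ball of radius [2 e < r]
   about [x]. *)
have /rat_in_itvoo[e] : 0 < r / 2 by rewrite divr_gt0.
rewrite in_itv/= => /andP[e_gt0 e_lt].
have qP i : exists q : rat, `|ratr q - x 0 i| < ratr e.
  have /rat_in_itvoo[q] : x 0 i - ratr e < x 0 i + ratr e by lra.
  by rewrite in_itv/= => qx; exists q; rewrite ltr_distl.
have [q qx] := choice qP.
have bx : ball (map_mx ratr (\row_i q i) : 'rV[R]_d) (ratr e) x.
  by split => // i j; rewrite ord1 !mxE; exact: qx.
exists (\row_i q i), e; split => // y by_; apply: rU.
apply: (le_ball (e1 := ratr e + ratr e)); first by lra.
exact: ball_triangle (ball_sym bx) by_.
Qed.

(** Sup-norm balls are boxes, so their preimages are finite intersections of coordinate preimages,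
    and each open set is a countable union of rational balls. *)
Lemma measurable_fun_rV dT (T : measurableType dT) (f : T -> borel_rV R d) :
  (forall i, measurable_fun [set: T] (fun t => f t 0 i)) ->
  measurable_fun [set: T] f.
Proof.
move=> mf.
apply: (@measurability _ _ _ (borel_rV R d) _ _ (@open 'rV[R]_d)) => //.
move=> _ [U oU <-]; rewrite setTI.
pose rball (k : 'rV[rat]_d * rat) : set 'rV[R]_d :=
  ball (map_mx ratr k.1 : 'rV[R]_d) (ratr k.2).
have mball k : measurable (f @^-1` rball k).
  (* A nonpositive radius gives the empty ball. It is treated apart because the intersection over
     coordinates below would be everything when [d = 0]. *)
  have [e_gt0|e_le0] := ltP (0 : R) (ratr k.2); last first.
    rewrite (_ : _ @^-1` _ = set0) //; apply/seteqP; split => // t [].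
    by rewrite ltNge e_le0.
  have -> : f @^-1` rball k = \bigcap_(i in [set: 'I_d])
      ((fun t => f t 0 i) @^-1` ball (ratr (k.1 0 i) : R) (ratr k.2)).
    apply/seteqP; split => [t [_ kt] i _|t kt].
      by have := kt 0 i; rewrite mxE.
    by split=> // i j; rewrite ord1 mxE; exact: kt.
  apply: fin_bigcap_measurable => // i _; rewrite -[X in measurable X]setTI.
  by apply: mf => //; apply: open_measurable; exact: ball_open.
have -> : f @^-1` U =
    \bigcup_k (if `[< rball k `<=` U >] then f @^-1` rball k else set0).
  apply/seteqP; split => [t Uft|t [k _]].
    have [q [e [bt bU]]] := rat_ball_rV oU Uft.
    by exists (q, e) => //; case: asboolP.
  by case: asboolP => // kU; exact: kU.
apply: countable_bigcupT_measurable => [|k]; first exact: countableP.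
by case: asboolP.
Qed.

Lemma measurable_fun_subZ dT (T : measurableType dT)
    (f g : T -> borel_rV R d) (a : R) :
  measurable_fun [set: T] f -> measurable_fun [set: T] g ->
  measurable_fun [set: T] (fun t => f t - a *: g t : borel_rV R d).
Proof.
move=> mf mg; apply: measurable_fun_rV => i.
have -> : (fun t => (f t - a *: g t) 0 i) =
    (fun t => f t 0 i - a * g t 0 i).
  by apply/funext => t; rewrite !mxE.
apply: measurable_funB; first exact: (measurableT_comp (measurable_coord i)).
apply: measurable_funM => //.
exact: (measurableT_comp (measurable_coord i)).
Qed.

End borel_measurability.

(** * Integrating out an independent variable *)

Section independence.
Local Open Scope ereal_scope.
Context d d1 d2 (Omega : measurableType d) (T1 : measurableType d1)
  (T2 : measurableType d2) (R : realType).

(** Factorisation on rectangles determines the joint law of [(X, Y)] as the product of the law of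
    [X] with [Q]. Tonelli applies to that product, and the outer integral is then pulled back to
    [Omega]. *)
Lemma integral_independent_pair (P : probability Omega R)
    (Q : probability T2 R) (X : {mfun Omega >-> T1}) (Y : {mfun Omega >-> T2})
    (f : T1 * T2 -> \bar R) :
  (forall A B, measurable A -> measurable B ->
    P (X @^-1` A `&` Y @^-1` B) = P (X @^-1` A) * Q B) ->
  measurable_fun [set: T1 * T2] f -> (forall x, 0 <= f x) ->
  \int[P]_w f (X w, Y w) = \int[P]_w \int[Q]_z f (X w, z).
Proof.
move=> indXY mf f_ge0.
have mXY : measurable_fun [set: Omega] (fun w => (X w, Y w)).
  by apply: measurable_fun_pair; exact: measurable_funP.
pose XY : {mfun Omega >-> (T1 * T2)%type} := mfun_Sub (mem_set mXY).
have lawXY : forall A, measurable A ->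
    (distribution P X \x Q) A = distribution P XY A.
  by apply: product_measure_unique => A B mA mB; rewrite -indXY.
transitivity (\int[distribution P XY]_z f z).
  by rewrite ge0_integral_distribution.
rewrite (eq_measure_integral (distribution P X \x Q)); last first.
  by move=> A mA _; exact/esym/lawXY.
rewrite fubini_tonelli1// ge0_integral_distribution//.
- exact: measurable_fun_fubini_tonelli_F.
- by move=> x; apply: integral_ge0 => z _.
Qed.

End independence.

(** * Mean square of one unprojected step from a frozen point *)

Section mean_step.
Context {R : realType} {d : nat} {dZ : measure_display}.
Context {Zt : measurableType dZ}.
Variables (Q : probability Zt R) (g : Zt -> 'rV[R]_d) (G0 : R).
Hypothesis mg : forall i, measurable_fun [set: Zt] (fun z => g z 0 i).
Hypothesis g_le : forall z, enorm (g z) <= G0.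

Let integrable_coord i : Q.-integrable [set: Zt] (fun z => (g z 0 i)%:E).
Proof.
apply: measurable_bounded_integrable => //.
  exact: le_lt_trans (probability_le1 Q measurableT) (ltry 1).
exists G0; split; first exact: num_real.
move=> M ltM z _; apply/ltW/(le_lt_trans _ ltM)/le_trans/g_le.
exact: coord_le_enorm.
Qed.

(** Linearity over the coordinates. Taking [fine] loses nothing, since bounded coordinates have
    finite expectation. *)
Lemma integral_dotl (v : 'rV[R]_d) :
  (\int[Q]_z (dot v (g z))%:E =
   (dot v (\row_i fine 'E_Q[fun z => g z 0%R i]))%:E)%E.
Proof.
under eq_integral do rewrite -sumEFin.
rewrite integral_sum//; last first.
  by move=> i; under eq_fun do rewrite EFinM; exact: integrableZl.
rewrite -sumEFin; apply: eq_bigr => i _.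
under eq_integral do rewrite EFinM.
rewrite integralZl// mxE EFinM unlock fineK//.
exact: integrable_fin_num.
Qed.

Let integrable_dotl (v : 'rV[R]_d) :
  Q.-integrable [set: Zt] (fun z => (dot v (g z))%:E).
Proof.
under eq_fun do rewrite -sumEFin.
apply: integrable_sum => // i _.
by under eq_fun do rewrite EFinM; exact: integrableZl.
Qed.

(** Replacing [|g z|^2] by [G0 ^+ 2] before integrating leaves an integrand affine in [g z], whose
    integral is known exactly. *)
Lemma integral_sqr_step_le (v : 'rV[R]_d) (a : R) :
  (\int[Q]_z (dot (v - a *: g z)%R (v - a *: g z)%R)%:E <=
   (dot v v - 2 * a * dot v (\row_i fine 'E_Q[fun z => g z 0%R i])
    + a ^+ 2 * G0 ^+ 2)%:E)%E.
Proof.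
pose c := dot v v + a ^+ 2 * G0 ^+ 2; pose u := (- 2 * a) *: v.
have stepE z : dot (v - a *: g z) (v - a *: g z) <= c + dot u (g z).
  have : dot (g z) (g z) <= G0 ^+ 2.
    rewrite -enorm_sqr lerXn2r ?nnegrE ?sqrtr_ge0//.
    (* Nonnegativity of [G0], required for squaring the bound, comes from the bound itself at
       [z]. *)
    by rewrite (le_trans _ (g_le z)) ?sqrtr_ge0.
  move=> /(ler_wpM2l (sqr_ge0 a)).
  by rewrite dotB_sqr /u /c !dotZr !dotZl; lra.
have mdot w : measurable_fun [set: Zt] (fun z => dot w (g z)).
  by apply: measurable_sum => i; exact: measurable_funM.
apply: (@le_trans _ _ (\int[Q]_z (c%:E + (dot u (g z))%:E))%E).
  apply: ge0_le_integral => //.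
  - by move=> z _; rewrite lee_fin dot_ge0.
  - apply/measurable_EFinP/measurable_sum => i.
    have mi : measurable_fun [set: Zt] (fun z => (v - a *: g z) 0 i).
      under eq_fun do rewrite !mxE.
      by apply: measurable_funB => //; exact: measurable_funM.
    exact: measurable_funM.
  - by apply/measurable_EFinP/measurable_funD => //; exact: mdot.
  - by move=> z _; rewrite -EFinD lee_fin.
rewrite integralD//; last exact: finite_measure_integrable_cst.
rewrite integral_cst//= probability_setT mule1 integral_dotl -EFinD lee_fin.
by rewrite /u /c dotZl; lra.
Qed.

End mean_step.

(** * The stochastic iterates: adaptedness, independence and one-step contraction *)

Section iterates.
Context {R : realType} {d : nat} {dO dZ : measure_display}.
Context {Omega : measurableType dO} {Zt : measurableType dZ}.
Variables (P : probability Omega R) (P0 : probability Zt R).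
Variables (G : 'rV[R]_d -> Zt -> 'rV[R]_d) (Z : nat -> {RV P >-> Zt}).
Variables (B : set 'rV[R]_d) (theta0 : 'rV[R]_d) (eta : R).
Hypothesis mG : measurable_fun [set: borel_rV R d * Zt]
  (fun x : borel_rV R d * Zt => G x.1 x.2 : borel_rV R d).
Hypotheses (B0 : B !=set0) (cB : closed B) (convB : convex_set B).
Hypothesis B_theta0 : B theta0.

Let theta t om := iterate B eta G theta0 Z t om.
Let hist t := history (cst theta0 : Omega -> borel_rV R d) Z t.

Lemma iterate_in t om : B (theta t om).
Proof. by case: t => [|t] //=; exact: eproj_in. Qed.

Lemma sub_history s t : (s <= t)%N -> hist s `<=` hist t.
Proof.
move=> st; apply: sub_sigma_algebra2 => A [?|[r /= /andP[r1 rs] ?]].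
  by left.
right.
by exists r => //=; rewrite r1 (leq_trans rs).
Qed.

Lemma history_measurable t : hist t `<=` @measurable _ Omega.
Proof.
apply: smallest_sub; first exact: sigma_algebra_measurable.
move=> A [|[s _]] [C mC <-]; first exact: measurable_cst.
exact: measurable_funP.
Qed.

(** Adaptedness, by induction: the next iterate is a Borel function of the current one and of
    [Z t.+1], both measurable for the enlarged history. *)
Lemma history_iterate t (A : set (borel_rV R d)) : measurable A ->
  hist t (theta t @^-1` A).
Proof.
(* [Omega] is re-equipped with the history as its sigma-algebra, so that adaptedness becomes
   ordinary measurability and composition lemmas apply. *)
suff mth : measurable_fun [set: g_sigma_algebraType
    (preimage_set_system setT
        (cst theta0 : Omega -> borel_rV R d) measurable `|`
      \bigcup_(s in [set s | (1 <= s <= t)%N])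
        preimage_set_system setT (Z s) measurable)]
    (theta t : _ -> borel_rV R d).
  by move=> mA; rewrite -[X in hist t X]setTI; exact: mth.
elim: t => [|t IH]; first exact: measurable_cst.
set gen := (X in g_sigma_algebraType X).
pose T := g_sigma_algebraType gen.
have mth : measurable_fun [set: T] (theta t : T -> borel_rV R d).
  move=> _ C mC; apply: (@sub_history t t.+1) => //.
  exact: IH.
have mZ : measurable_fun [set: T] (Z t.+1 : T -> Zt).
  move=> _ C mC; apply: sub_sigma_algebra; right; exists t.+1 => /=.
    by rewrite leqnn.
  by exists C.
apply: (measurableT_comp (continuous_endo_measurable
  (continuous_eproj B0 cB convB))).
apply: measurable_fun_subZ => //.
exact: (measurableT_comp mG (measurable_fun_pair mth mZ)).
Qed.

Lemma measurable_iterate t :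
  measurable_fun [set: Omega] (theta t : Omega -> borel_rV R d).
Proof.
move=> _ A mA; rewrite setTI.
exact: (history_measurable (history_iterate mA)).
Qed.

Hypothesis U1 : forall t,
  is_cond_distribution P (hist t) (Z t.+1) (fun=> P0).

(** The conditional law is the constant kernel [P0], so its integral over the history event given by
    [A] is a constant times the probability of that event. *)
Lemma iterate_indep t (A : set (borel_rV R d)) C :
  measurable A -> measurable C ->
  (P (theta t @^-1` A `&` Z t.+1 @^-1` C) = P (theta t @^-1` A) * P0 C)%E.
Proof.
move=> mA mC; have [_ <-] := U1 t mC; last exact: history_iterate.
rewrite integral_cst 1?muleC//.
exact: (history_measurable (history_iterate mA)).
Qed.

Variables (G0 mu : R) (p : 'rV[R]_d).
Hypothesis G_le : forall th z, enorm (G th z) <= G0.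
Hypothesis eta_ge0 : 0 <= eta.
Hypothesis B_p : B p.
Hypothesis monotone : forall th, B th ->
  mu * enorm (th - p) ^+ 2 <= dot (th - p) (mean_field P0 G th).

Lemma measurable_sqr_dist (q : 'rV[R]_d) :
  measurable_fun [set: borel_rV R d]
    (fun th : borel_rV R d => (dot (th - q) (th - q) : R)).
Proof.
apply: (continuous_measurable_borel_rV (f := fun th => dot (th - q) (th - q))).
have -> : (fun th => dot (th - q) (th - q)) = (fun th => dot (q - th) (q - th)).
  by apply/funext => th; rewrite !dotB_sqr (dotC th); ring.
exact: continuous_dot_sub.
Qed.

Lemma mean_sqr_dist_step t : 2 * mu * eta <= 1 ->
  (\int[P]_om (enorm (theta t.+1 om - p) ^+ 2)%:E <=
   (1 - 2 * mu * eta)%:E * \int[P]_om (enorm (theta t om - p) ^+ 2)%:E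
   + (eta ^+ 2 * G0 ^+ 2)%:E)%E.
Proof.
move=> rho_ge0.
(* The squared distance to [p] before projection, as a function of the pair (current iterate, fresh
   draw). *)
pose phi (x : borel_rV R d * Zt) : R :=
  dot (x.1 - eta *: G x.1 x.2 - p) (x.1 - eta *: G x.1 x.2 - p).
have mphi : measurable_fun [set: borel_rV R d * Zt] phi.
  apply: (measurableT_comp (measurable_sqr_dist p)).
  exact: measurable_fun_subZ.
have mD s : measurable_fun [set: Omega] (fun om => enorm (theta s om - p) ^+ 2).
  under eq_fun do rewrite enorm_sqr.
  exact: (measurableT_comp (measurable_sqr_dist p) (measurable_iterate s)).
pose X : {mfun Omega >-> borel_rV R d} :=
  mfun_Sub (mem_set (@measurable_iterate t)).
apply: (@le_trans _ _ (\int[P]_om (phi (X om, Z t.+1 om))%:E)%E).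
  apply: ge0_le_integral => //.
  - by move=> om _; rewrite lee_fin sqr_ge0.
  - exact/measurable_EFinP/mD.
  - apply/measurable_EFinP/(measurableT_comp mphi)/measurable_fun_pair => //.
  - move=> om _; rewrite lee_fin enorm_sqr /=.
    (* Writing [p] as its own projection turns the left side into a distance between two
       projections. *)
    by rewrite -{1 2}(eproj_id B0 cB B_p); exact: eproj_nonexpansive.
rewrite (integral_independent_pair (Q := P0) (f := EFin \o phi))//; first last.
- by move=> x; rewrite lee_fin dot_ge0.
- exact/measurable_EFinP.
- exact: iterate_indep.
(* Pointwise in [om], the inner integral over the fresh draw is bounded by the mean step estimate
   with [theta t om] frozen; [monotone] applies because the iterate lies in [B]. *)
apply: (@le_trans _ _ (\int[P]_om ((1 - 2 * mu * eta)%:E *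
    (enorm (theta t om - p) ^+ 2)%:E + (eta ^+ 2 * G0 ^+ 2)%:E))%E).
  apply: ge0_le_integral => //.
  - by move=> om _; apply: integral_ge0 => z _; rewrite lee_fin dot_ge0.
  - have mF := measurable_fun_fubini_tonelli_F (m2 := P0) (EFin \o phi).
    apply: (measurableT_comp (mF _ _) (measurable_funP X)).
    + exact/measurable_EFinP.
    + by move=> x; rewrite lee_fin dot_ge0.
  - apply: emeasurable_funD => //; apply/measurable_EFinP.
    exact: measurable_funM.
  - move=> om _.
    have mGth i : measurable_fun [set: Zt] (fun z => G (theta t om) z 0 i).
      apply: (measurableT_comp (measurable_coord i)).
      exact: (measurableT_comp mG (pair1_measurable _)).
    have := integral_sqr_step_le P0 mGth (G_le (theta t om))
      (theta t om - p) eta.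
    under eq_integral do rewrite addrAC.
    move=> /le_trans; apply.
    rewrite -EFinM -EFinD lee_fin.
    have := monotone (iterate_in t om); rewrite enorm_sqr /mean_field.
    by move=> /(ler_wpM2l eta_ge0); lra.
(* Since [1 - 2 * mu * eta] is nonnegative, both summands are nonnegative, so the integral splits
   and scales without any integrability of the squared distance. *)
rewrite ge0_integralD//; first last.
- by move=> om _; rewrite lee_fin mulr_ge0 ?sqr_ge0.
- by apply/measurable_EFinP/measurable_funM.
- by move=> om _; rewrite -EFinM lee_fin mulr_ge0 ?sqr_ge0 ?subr_ge0.
rewrite integral_cst//= probability_setT mule1 leeD2r//.
rewrite ge0_integralZl_EFin// ?subr_ge0//.
- by move=> om _; rewrite lee_fin sqr_ge0.
- exact/measurable_EFinP/mD.
Qed.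

End iterates.

(** * Unrolling the recursion into a geometric rate plus a noise floor *)

Theorem proposition3 (R : realType) (d : nat)
    (dO dZ : measure_display)
    (Omega : measurableType dO) (Zt : measurableType dZ)
    (P : probability Omega R) (P0 : probability Zt R)
    (W : Type) (loss : 'rV[R]_d -> Zt -> W -> R) (Wref : Zt -> W)
    (loss_diff : forall (z : Zt) (w : W) (theta : 'rV[R]_d),
      differentiable (fun th => loss th z w) theta)
    (G : 'rV[R]_d -> Zt -> 'rV[R]_d)
    (GE : G = clipped_field loss Wref)
    (theta0 : 'rV[R]_d)
    (Z : nat -> {RV P >-> Zt})
    (U1 : forall t : nat,
      is_cond_distribution P
        (history (cst theta0) Z t) (Z t.+1) (fun=> P0))
    (G0 : R) (G0E : G0 = 1)
    (U2_meas : measurable_fun [set: borel_rV R d * Zt]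
      (fun x : borel_rV R d * Zt => G x.1 x.2 : borel_rV R d))
    (U2_bound : forall (theta : 'rV[R]_d) (z : Zt), enorm (G theta z) <= G0)
    (B : set 'rV[R]_d)
    (B_nonempty : B !=set0) (B_closed : closed B) (B_convex : convex_set B)
    (thetadag : 'rV[R]_d) (B_thetadag : B thetadag)
    (h_thetadag : mean_field P0 G thetadag = 0)
    (mu : R) (mu_gt0 : 0 < mu)
    (U3 : forall theta : 'rV[R]_d, B theta ->
      mu * enorm (theta - thetadag) ^+ 2
        <= dot (theta - thetadag) (mean_field P0 G theta))
    (eta : R) (eta_gt0 : 0 < eta) (eta_lt : eta < 1 / (2 * mu))
    (B_theta0 : B theta0)
    (T : nat) :
  ('E_P[fun om =>
      (enorm (iterate B eta G theta0 Z T om - thetadag) ^+ 2)%R]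
    <= ((1 - 2 * mu * eta) ^+ T * enorm (theta0 - thetadag) ^+ 2
        + eta * G0 ^+ 2 / (2 * mu))%R%:E)%E.
Proof.
have rho_le1 : 2 * mu * eta <= 1.
  move: eta_lt; rewrite ltr_pdivlMr ?mulr_gt0// => /ltW; apply: le_trans.
  by rewrite [leRHS]mulrC.
rewrite unlock; elim: T => [|t IH].
  (* At time zero the iterate is deterministic, so only the nonnegativity of the noise floor is left
     to check. *)
  rewrite /= expr0 mul1r integral_cst//= probability_setT mule1 lee_fin lerDl.
  have [eta_ge0 mu_ge0] := (ltW eta_gt0, ltW mu_gt0).
  by apply: divr_ge0; apply: mulr_ge0 => //; exact: sqr_ge0.
apply: le_trans (mean_sqr_dist_step U2_meas B_nonempty B_closed B_convex
  B_theta0 U1 U2_bound (ltW eta_gt0) B_thetadag U3 t rho_le1) _.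
apply: (@le_trans _ _ ((1 - 2 * mu * eta)%:E * (((1 - 2 * mu * eta) ^+ t *
    enorm (theta0 - thetadag) ^+ 2 + eta * G0 ^+ 2 / (2 * mu))%R%:E)
    + (eta ^+ 2 * G0 ^+ 2)%:E)%E).
  by rewrite leeD2r// lee_wpmul2l// lee_fin subr_ge0.
rewrite -EFinM -EFinD lee_fin (exprS (1 - _)).
(* The two sides are equal: [(1 - 2 mu eta) * eta G0^2 / (2 mu) + eta^2 G0^2 = eta G0^2 / (2
   mu)]. *)
rewrite le_eqVlt; apply/orP; left; apply/eqP; field.
by rewrite gt_eqF.
Qed.
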